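(* Let $(R,\mathfrak m,k)$ be a one-dimensional analytically irreducible local domain with canonical map $k\to\overline R/\mathfrak n$ an isomorphism, and with $v,a_i,n,I_i,\mathcal T(-),\mathcal I(R)$ as in the context. Assume $\mathcal I(R)=\mathcal T(R)$. Let $1\le i\le n$ and let $q_i\in R$ with $v(q_i)=a_i$. Then $$\mathcal T(I_i:I_i)=\begin{cases}\{q_i^{-1}I_j\mid i\le j\le n\} & \text{if } I_i^2=q_iI_i,\\ \{q_i^{-1}I_j\mid i+2\le j\le n\}\cup\{I_i:I_i\} & \text{if } I_i^2\ne q_iI_i.\end{cases}$$ In particular, $\mathcal T(I_i:I_i)$ is a finite set.
   Context: $\overline R$ is the integral closure of $R$ in $Q(R)$, assumed finitely generated over $R$ and local, with maximal ideal $\mathfrak n$; $v$ is the normalized valuation of $\overline R$. $H=v(R)=\{a_0=0<a_1<\cdots\}$, $n$ is the smallest integer with $a_{n+i}=a_n+i$ for all $i\ge 0$, $I_i=\{r\in R\mid v(r)\ge a_i\}$ ($0\le i\le n$), $\mathcal I(R)=\{I_0,\dots,I_n\}$. For fractional ideals $X,Y$, $X:Y=\{x\in Q(R)\mid xY\subseteq X\}$; $I_i:I_i$ is a ring between $R$ and $\overline R$. For a ring $A$, $\mathcal T(A)$ is the set of trace ideals of $A$ containing a non-zerodivisor, where the trace ideal of an $A$-module $M$ is $\sum_{f\in\mathrm{Hom}_A(M,A)}\mathrm{Im}f$. *)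

(* Defs.v *)
(* Setting: R is a subring of a field K with K = Q(R);
   ideals / fractional ideals / subrings are predicates K -> Prop. *)
From HB Require Import structures.
From mathcomp Require Import all_boot all_order all_algebra.
Set Implicit Arguments. Unset Strict Implicit. Unset Printing Implicit Defensive.
Import Order.TTheory GRing.Theory Num.Theory.
Local Open Scope ring_scope.

Section Defs.
Variable K : fieldType.

Definition eqI (X Y : K -> Prop) := forall x, X x <-> Y x.
Definition subI (X Y : K -> Prop) := forall x, X x -> Y x.
Definition ssubI (X Y : K -> Prop) := subI X Y /\ exists x, Y x /\ ~ X x.

Definition subring (R : K -> Prop) :=
  [/\ R 1, (forall x y, R x -> R y -> R (x - y)) & (forall x y, R x -> R y -> R (x * y))].

Definition is_frac_field (R : K -> Prop) :=
  forall x, exists a b, [/\ R a, R b, b != 0 & x = a / b].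

Definition is_unit_in (R : K -> Prop) (x : K) := x != 0 /\ R x /\ R x^-1.
Definition nonunit_in (R : K -> Prop) (x : K) := R x /\ ~ is_unit_in R x.

Definition is_local (R : K -> Prop) :=
  forall x y, nonunit_in R x -> nonunit_in R y -> nonunit_in R (x + y).

Definition ideal_of (R : K -> Prop) (I : K -> Prop) :=
  [/\ subI I R, I 0, (forall x y, I x -> I y -> I (x + y))
    & (forall r x, R r -> I x -> I (r * x))].

Definition prime_ideal_of (R : K -> Prop) (P : K -> Prop) :=
  [/\ ideal_of R P, ~ P 1 & forall a b, R a -> R b -> P (a * b) -> P a \/ P b].

Definition krull_dim_one (R : K -> Prop) :=
  (exists P Q, [/\ prime_ideal_of R P, prime_ideal_of R Q & ssubI P Q]) /\
  ~ (exists P Q S, [/\ prime_ideal_of R P, prime_ideal_of R Q, prime_ideal_of R S,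
                       ssubI P Q & ssubI Q S]).

Definition Rspan (R : K -> Prop) (k : nat) (g : 'I_k -> K) (x : K) :=
  exists c : 'I_k -> K, (forall j, R (c j)) /\ x = \sum_(j < k) c j * g j.

Definition noetherian (R : K -> Prop) :=
  forall I, ideal_of R I -> exists k (g : 'I_k -> K),
    (forall j, I (g j)) /\ eqI I (Rspan R g).

Definition integral_over (R : K -> Prop) (x : K) :=
  exists p : {poly K}, [/\ p \is monic, (forall k, R p`_k) & root p x].

Definition fin_gen_over (R S : K -> Prop) :=
  exists k (g : 'I_k -> K), eqI S (Rspan R g).

(* v is the normalized (discrete) valuation of the DVR Rbar; v x is only
   meaningful for x != 0 (v 0 = +oo by convention, handled explicitly). *)
Definition normalized_valuation_of (Rbar : K -> Prop) (v : K -> int) :=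
  [/\ (forall x y, x != 0 -> y != 0 -> v (x * y) = v x + v y),
      (forall x y, x != 0 -> y != 0 -> x + y != 0 -> Num.min (v x) (v y) <= v (x + y)),
      (exists t, t != 0 /\ v t = 1)
    & (forall x, x != 0 -> (Rbar x <-> 0 <= v x))].

(* "v x >= c" with the convention v 0 = +oo *)
Definition vge (v : K -> int) (c : int) (x : K) := x = 0 \/ c <= v x.
Definition vgt (v : K -> int) (c : int) (x : K) := x = 0 \/ c < v x.

Definition value_set (R : K -> Prop) (v : K -> int) (h : int) :=
  exists r, [/\ R r, r != 0 & v r = h].

Definition Iv (R : K -> Prop) (v : K -> int) (a : nat -> int) (j : nat) (x : K) :=
  R x /\ vge v (a j) x.

Definition colon (X Y : K -> Prop) (x : K) := forall y, Y y -> X (x * y).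

Definition prodI (X Y : K -> Prop) (x : K) :=
  exists k (xs ys : 'I_k -> K),
    (forall j, X (xs j) /\ Y (ys j)) /\ x = \sum_(j < k) xs j * ys j.

Definition scaleI (c : K) (X : K -> Prop) (x : K) := exists y, X y /\ x = c * y.

Definition is_module (A : K -> Prop) (M : zmodType) (act : K -> M -> M) :=
  [/\ (forall a m1 m2, A a -> act a (m1 + m2) = act a m1 + act a m2),
      (forall a b m, A a -> A b -> act (a + b) m = act a m + act b m),
      (forall a b m, A a -> A b -> act (a * b) m = act a (act b m))
    & (forall m, act 1 m = m)].

Definition is_hom_to (A : K -> Prop) (M : zmodType) (act : K -> M -> M) (f : M -> K) :=
  [/\ (forall m, A (f m)),
      (forall m1 m2, f (m1 + m2) = f m1 + f m2)
    & (forall a m, A a -> f (act a m) = a * f m)].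

Definition trace_ideal (A : K -> Prop) (M : zmodType) (act : K -> M -> M) (x : K) :=
  exists k (fs : 'I_k -> M -> K) (ms : 'I_k -> M),
    (forall j, is_hom_to A act (fs j)) /\ x = \sum_(j < k) fs j (ms j).

Definition in_T (A : K -> Prop) (J : K -> Prop) :=
  (exists (M : zmodType) (act : K -> M -> M),
      is_module A act /\ eqI J (trace_ideal A act)) /\
  (exists x, J x /\ forall y, A y -> x * y = 0 -> y = 0).

End Defs.

(* Main.v *)
(* A nonzero ideal J of a domain A is a trace ideal iff A : J = J : J. Put
   A = I_i : I_i = R : I_i. If J is a trace ideal of A, then I_i J is one of R,
   so I_i J = I_j for some j >= i by hypothesis. If I_i^2 = q I_i then I_i = q A
   and J = q^-1 I_j. Otherwise the point is that I_i I_(i+2) is contained in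
   q I_i, which follows by applying the hypothesis to the traces of the ideals
   R w + I_(l+1). Hence A consists of its units and of q^-1 I_(i+2), and for
   J <> A one may choose y in R of value a_(i+1) with (y / q) J contained in A,
   hence in J; this forces I_j = I_i J = q J. *)
Require Import Defs.
From HB Require Import structures.
From mathcomp Require Import all_boot all_order all_algebra.
From mathcomp Require Import boolp zify ring.
Import Order.TTheory GRing.Theory Num.Theory.
Local Open Scope ring_scope.
Set Implicit Arguments. Unset Strict Implicit. Unset Printing Implicit Defensive.

Lemma sum_match_split (V : zmodType) (k l : nat) (F : 'I_k -> V) (G : 'I_l -> V) :
  \sum_(j < k + l) match split j with inl b => F b | inr c => G c end =
  \sum_(j < k) F j + \sum_(j < l) G j.
Proof.
rewrite big_split_ord /=; congr (_ + _); apply: eq_bigr => j _.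
- by rewrite -[lshift _ _]/(unsplit (inl j)) unsplitK.
- by rewrite -[rshift _ _]/(unsplit (inr j)) unsplitK.
Qed.

(** * Additive subgroups of a field as [zmodType]s *)

Section SubmoduleType.
Variables (K : fieldType) (J : K -> Prop).
Definition zmod_closedI := J 0 /\ forall x y, J x -> J y -> J (x - y).
(** The closure proof is an argument so that the [isZmodClosed] instance can be attached to the
    predicate itself. *)
Definition asbool_pred (_ : zmod_closedI) : {pred K} := fun x => `[< J x >].
Variable hJ : zmod_closedI.

Fact asbool_pred_zmod_closed : zmod_closed (asbool_pred hJ).
Proof.
split=> [|x y /asboolP hx /asboolP hy]; apply/asboolP; first exact: hJ.1.
exact: hJ.2.
Qed.
HB.instance Definition _ :=
  GRing.isZmodClosed.Build K (asbool_pred hJ) asbool_pred_zmod_closed.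

Record submod := Submod { submod_val : K; _ : submod_val \in asbool_pred hJ }.
HB.instance Definition _ := [isSub for submod_val].
HB.instance Definition _ := [Choice of submod by <:].
HB.instance Definition _ := [SubChoice_isSubZmodule of submod by <:].
End SubmoduleType.

(** * Characterization of the trace ideals of a domain *)

Section TraceCriterion.
Variables (K : fieldType) (A : K -> Prop).
Hypothesis hA : subring A.

Lemma subring0 : A 0.
Proof. by case: hA => h1 hB _; rewrite -(subrr 1); apply: hB. Qed.

Lemma subringN x : A x -> A (- x).
Proof. by case: hA => h1 hB _ hx; rewrite -(sub0r x); apply: hB => //; apply: subring0. Qed.

Lemma subringD x y : A x -> A y -> A (x + y).
Proof.
by move=> hx /subringN hy; rewrite -(opprK y); case: hA => _ hB _; apply: hB.
Qed.

Lemma subring_sum k (F : 'I_k -> K) : (forall j, A (F j)) -> A (\sum_j F j).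
Proof. by move=> h; apply: big_ind => //; [apply: subring0 | apply: subringD]. Qed.

Lemma trace_ideal_ideal (M : zmodType) (act : K -> M -> M) :
  ideal_of A (trace_ideal A act).
Proof.
case: (hA) => _ _ hM; split.
- move=> _ [k [fs [ms [hf ->]]]]; apply: subring_sum => j; by case: (hf j).
- by exists 0%N, (fun _ _ => 0), (fun _ => 0); split; [case | rewrite big_ord0].
- move=> _ _ [k [fs [ms [hf ->]]]] [l [gs [ns [hg ->]]]].
  exists (k + l)%N, (fun j => match split j with inl b => fs b | inr c => gs c end),
    (fun j => match split j with inl b => ms b | inr c => ns c end).
  split; first by move=> j; case: (split j).
  by rewrite -sum_match_split; apply: eq_bigr => j _; case: (split j).
- move=> r _ hr [k [fs [ms [hf ->]]]].
  exists k, fs, (fun j => act r (ms j)); split=> //.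
  by rewrite mulr_sumr; apply: eq_bigr => j _; case: (hf j) => _ _ ->.
Qed.

(** Composing a homomorphism into [A] with multiplication by [x] gives another homomorphism into
    [A]. *)
Lemma trace_ideal_colon (M : zmodType) (act : K -> M -> M) x :
  colon A (trace_ideal A act) x ->
  colon (trace_ideal A act) (trace_ideal A act) x.
Proof.
move=> hx _ [k [fs [ms [hf ->]]]].
exists k, (fun j m => x * fs j m), ms; split; last by rewrite mulr_sumr.
move=> j; case: (hf j) => h1 h2 h3; split.
- move=> m; apply: hx; exists 1%N, (fun _ => fs j), (fun _ => m).
  by split=> //; rewrite big_ord1.
- by move=> m1 m2; rewrite h2 mulrDr.
- by move=> b m hb; rewrite h3 // mulrCA.
Qed.

(* A nonzero ideal of a domain is a trace ideal iff it is its own trace, and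
   homomorphisms from it to A are multiplications by elements of the fraction
   field. *)
Lemma in_T_iff (J : K -> Prop) :
  in_T A J <->
  [/\ ideal_of A J, exists x, J x /\ x != 0 & subI (colon A J) (colon J J)].
Proof.
case: (hA) => hA1 _ hAM; split.
  move=> [[M [act [_ hJ]]] [x [hx hreg]]]; split.
  - case: (trace_ideal_ideal act) => h1 h2 h3 h4; split.
    + by move=> y /hJ /h1.
    + exact/hJ.
    + by move=> y z /hJ hy /hJ hz; apply/hJ/h3.
    + by move=> r y hr /hJ hy; apply/hJ/h4.
  - exists x; split=> //; apply/eqP => x0.
    by have /eqP := hreg 1 hA1 (etrans (mulr1 x) x0); rewrite oner_eq0.
  - move=> y hy z /hJ hz; apply/hJ; apply: trace_ideal_colon hz => w /hJ hw.
    exact: hy.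
move=> [[hJA hJ0 hJD hJM] [x0 [hx0 nz]] hc].
have hJz : zmod_closedI J.
  split=> // x y hx hy; rewrite -mulN1r; apply: hJD => //; apply: hJM => //.
  exact: subringN.
have valJ (m : submod hJz) : J (val m) by apply/asboolP/(valP m).
(* The default 0 occurs only when [b * val m] leaves [J], hence never for a scalar in [A]. *)
pose act (b : K) (m : submod hJz) : submod hJz := insubd 0 (b * val m).
have actE b m : A b -> val (act b m) = b * val m.
  by move=> hb; rewrite insubdK //; apply/asboolP/hJM.
split; last first.
  by exists x0; split=> // y _ /eqP; rewrite mulf_eq0 (negPf nz) => /eqP.
exists (submod hJz : zmodType), act; split.
  split.
  - by move=> b m1 m2 hb; apply: val_inj; rewrite raddfD /= !actE // raddfD mulrDr.
  - move=> b c m hb hc'; apply: val_inj; rewrite raddfD /= !actE ?mulrDl //.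
    exact: subringD.
  - move=> b c m hb hc'; apply: val_inj; rewrite /= !actE ?mulrA //.
    exact: hAM.
  - by move=> m; apply: val_inj; rewrite /= actE ?mul1r.
have homJ f m : is_hom_to A act f -> J (f m).
  move=> [h1 _ h3].
  pose x0' : submod hJz := Submod (asboolT hx0 : x0 \in asbool_pred hJz).
  (* Letting [m'] and [x0] act on each other gives the same element, so linearity yields
     [val m' * f x0' = x0 * f m']. *)
  have E m' : f m' = f x0' / x0 * val m'.
    have AV (m1 : submod hJz) : A (val m1) by apply/hJA/valJ.
    have : act (val m') x0' = act (val x0') m'.
      by apply: val_inj; rewrite !actE ?AV //; apply: mulrC.
    move/(congr1 f); rewrite !h3 // => e.
    by apply: (mulfI nz); rewrite -[LHS]e; field.
  rewrite E; apply: hc; last exact: valJ.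
  move=> y hy; pose y' : submod hJz := Submod (asboolT hy : y \in asbool_pred hJz).
  by rewrite -[y]/(val y') -E; apply: h1.
move=> x; split.
  move=> hx; exists 1%N, (fun _ => val),
    (fun _ => Submod (asboolT hx : x \in asbool_pred hJz)).
  split; last by rewrite big_ord1.
  move=> _; split.
  - by move=> m; apply/hJA/valJ.
  - by move=> m1 m2; rewrite raddfD.
  - by move=> b m hb; rewrite actE.
move=> [k [fs [ms [hf ->]]]].
by apply: big_ind => // j _; apply: homJ.
Qed.

End TraceCriterion.

(** * Products, quotients and traces of submodules of [K] *)

Section ProductIdeal.
Variable K : fieldType.
Implicit Types X Y P : K -> Prop.

Lemma prodI0 X Y : prodI X Y 0.
Proof. by exists 0%N, (fun _ => 0), (fun _ => 0); split; [case | rewrite big_ord0]. Qed.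

Lemma prodI_mul X Y x y : X x -> Y y -> prodI X Y (x * y).
Proof.
by move=> hx hy; exists 1%N, (fun _ => x), (fun _ => y); rewrite big_ord1.
Qed.

Lemma prodI_add X Y x y : prodI X Y x -> prodI X Y y -> prodI X Y (x + y).
Proof.
move=> [k [xs [ys [h ->]]]] [l [zs [ws [h' ->]]]].
exists (k + l)%N, (fun j => match split j with inl b => xs b | inr c => zs c end),
  (fun j => match split j with inl b => ys b | inr c => ws c end).
split; first by move=> j; case: (split j).
by rewrite -sum_match_split; apply: eq_bigr => j _; case: (split j).
Qed.

Lemma prodI_ind X Y P : P 0 -> (forall x y, P x -> P y -> P (x + y)) ->
  (forall x y, X x -> Y y -> P (x * y)) -> subI (prodI X Y) P.
Proof.
move=> h0 hD hM _ [k [xs [ys [h ->]]]].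
by apply: big_ind => // j _; case: (h j) => *; apply: hM.
Qed.

Lemma prodI_scale X Y r : (forall y, Y y -> Y (r * y)) ->
  forall z, prodI X Y z -> prodI X Y (r * z).
Proof.
move=> hY; apply: prodI_ind; first by rewrite mulr0; apply: prodI0.
  by move=> x y hx hy; rewrite mulrDr; apply: prodI_add.
by move=> x y hx hy; rewrite mulrCA; apply: prodI_mul => //; apply: hY.
Qed.

Lemma scaleIV q X x : q != 0 -> scaleI q^-1 X x <-> X (q * x).
Proof.
move=> q0; split=> [[y [hy ->]]|hx]; first by rewrite mulVKf.
by exists (q * x); rewrite mulKf.
Qed.

Lemma colon_subring X : X 0 -> (forall x y, X x -> X y -> X (x - y)) ->
  subring (colon X X).
Proof.
move=> h0 hB; split=> [y hy|x y hx hy z hz|x y hx hy z hz].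
- by rewrite mul1r.
- by rewrite mulrBl; apply: hB; [apply: hx | apply: hy].
- by rewrite -mulrA; apply/hx/hy.
Qed.

(* A sum (A : X) X absorbs every z with z (A : X) X in A, because such a z maps
   A : X into itself. *)
Lemma in_T_trace (A X : K -> Prop) : subring A -> X 0 ->
  (forall x y, X x -> X y -> X (x + y)) -> (forall r x, A r -> X x -> X (r * x)) ->
  (exists2 c, colon A X c & exists2 x, X x & c * x != 0) ->
  in_T A (prodI (colon A X) X).
Proof.
move=> hA h0 hD hM [c hc [x hx nz]]; apply/(in_T_iff hA); split.
- split.
  + apply: prodI_ind; [exact: subring0 | exact: subringD |].
    by move=> y z hy hz; apply: hy.
  + exact: prodI0.
  + exact: prodI_add.
  + by move=> r y hr; apply: prodI_scale => z; apply: hM.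
- by exists (c * x); split=> //; apply: prodI_mul.
- move=> z hz; apply: prodI_ind.
  + by rewrite mulr0; apply: prodI0.
  + by move=> y w hy hw; rewrite mulrDr; apply: prodI_add.
  + move=> y w hy hw; rewrite mulrA; apply: prodI_mul => // u hu.
    by rewrite -mulrA; apply/hz/prodI_mul.
Qed.

End ProductIdeal.

(** * Valuation inequalities, with the value of 0 infinite *)

Section Valuation.
Variables (K : fieldType) (V : K -> Prop) (v : K -> int).
Hypothesis hv : normalized_valuation_of V v.
Implicit Types (x y w : K) (c d : int) (m : nat).

Lemma valuationM x y : x != 0 -> y != 0 -> v (x * y) = v x + v y.
Proof. by case: hv => h _ _ _; apply: h. Qed.

Lemma valuation1 : v 1 = 0.
Proof.
apply: (addrI (v 1)); rewrite addr0 -valuationM ?oner_eq0 //.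
by rewrite mulr1.
Qed.

Lemma valuationV x : x != 0 -> v x^-1 = - v x.
Proof.
move=> x0; have : v (x * x^-1) = 0 by rewrite divff ?valuation1.
by rewrite valuationM ?invr_eq0 //; lia.
Qed.

Lemma valuationN x : x != 0 -> v (- x) = v x.
Proof.
move=> x0; have N1 : (-1 : K) != 0 by rewrite oppr_eq0 oner_eq0.
have : v (-1 * -1) = 0 by rewrite mulrNN mulr1 valuation1.
by rewrite -(mulN1r x) !valuationM //; move: (v (-1)) => w; lia.
Qed.

Lemma vge0 x : V x -> vge v 0 x.
Proof.
case: hv => _ _ _ h hx; have [->|x0] := eqVneq x 0; first by left.
by right; apply/h.
Qed.

Lemma vge_val c x : x != 0 -> vge v c x -> c <= v x.
Proof. by move=> x0 [] // /eqP; rewrite (negPf x0). Qed.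

Lemma vge_le c d x : d <= c -> vge v c x -> vge v d x.
Proof. by move=> hdc [->|hx]; [left | right; apply: le_trans hx]. Qed.

Lemma vgt_vge c x : vgt v c x -> vge v (c + 1) x.
Proof. by move=> [->|hx]; [left | right; lia]. Qed.

Lemma vgeM c d x y : vge v c x -> vge v d y -> vge v (c + d) (x * y).
Proof.
move=> hx hy; have [->|x0] := eqVneq x 0; first by left; rewrite mul0r.
have [->|y0] := eqVneq y 0; first by left; rewrite mulr0.
by right; rewrite valuationM // lerD // vge_val.
Qed.

Lemma vgeN c x : vge v c x -> vge v c (- x).
Proof.
move=> hx; have [->|x0] := eqVneq x 0; first by left; rewrite oppr0.
by right; rewrite valuationN // vge_val.
Qed.

Lemma vgeD c x y : vge v c x -> vge v c y -> vge v c (x + y).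
Proof.
move=> hx hy; have [->|x0] := eqVneq x 0; first by rewrite add0r.
have [->|y0] := eqVneq y 0; first by rewrite addr0.
have [->|s0] := eqVneq (x + y) 0; first by left.
case: hv => _ h _ _; right; apply: le_trans (h _ _ x0 y0 s0).
by rewrite le_min !vge_val.
Qed.

Lemma vgeB c x y : vge v c x -> vge v c y -> vge v c (x - y).
Proof. by move=> hx /vgeN; apply: vgeD. Qed.

Lemma vge_div c x w : w != 0 -> vge v c x -> vge v (c - v w) (x / w).
Proof. by move=> w0 hx; rewrite -valuationV //; apply: vgeM => //; right. Qed.

Lemma vge_divr c x w : w != 0 -> vge v (c + v w) (x * w) -> vge v c x.
Proof. by move=> w0 /(vge_div w0); rewrite mulfK // addrK. Qed.

Lemma val_perturb x y c : x != 0 -> v x < c -> vge v c (y - x) ->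
  y != 0 /\ v y = v x.
Proof.
move=> x0 hc hyx.
have yx : vge v (v x) y.
  by rewrite -(subrK x y); apply: vgeD; [apply: vge_le hyx; lia | right].
have y0 : y != 0.
  apply/eqP => y0; move: hyx; rewrite y0 sub0r => /vgeN; rewrite opprK.
  by move/(vge_val x0); lia.
split=> //; apply/eqP; rewrite eq_le (vge_val y0 yx) andbT leNgt; apply/negP => h.
(* If [v y] exceeded [v x], then [x = y - (y - x)] would be a difference of two terms of value above
   [v x]. *)
have : vge v (v x + 1) x.
  rewrite -[X in vge _ _ X](subKr y x); apply: vgeB; first by right; lia.
  by apply: vge_le hyx; lia.
by move/(vge_val x0); lia.
Qed.

Lemma vgeX c x m : vge v c x -> vge v (c * m%:Z) (x ^+ m).
Proof.
move=> hx; elim: m => [|m IH]; first by right; rewrite expr0 valuation1 mulr0.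
by rewrite exprS intS mulrDr mulr1; apply: vgeM.
Qed.

End Valuation.

(** * The filtration of [R] by value *)

Section ValueFiltration.
Variables (K : fieldType) (R : K -> Prop) (v : K -> int) (a : nat -> int) (n : nat).
Hypothesis hsub : subring R.
Hypothesis hfrac : is_frac_field R.
Hypothesis hfin : fin_gen_over R (integral_over R).
Hypothesis hv : normalized_valuation_of (integral_over R) v.
Hypothesis hres_inj : forall r, R r -> (nonunit_in R r <-> vgt v 0 r).
Hypothesis hres_surj :
  forall x, integral_over R x -> exists r, R r /\ vgt v 0 (x - r).
Hypothesis ha_incr : forall j, a j < a j.+1.
Hypothesis ha_H : forall h, value_set R v h <-> exists j, h = a j.
Hypothesis hn : forall j, a (n + j)%N = a n + j%:Z.
Hypothesis hIT : forall J, in_T R J <-> exists j, (j <= n)%N /\ eqI J (Iv R v a j).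
Implicit Types (x y z w r : K) (k l p m : nat).

Local Notation I := (Iv R v a).

Let R0 : R 0 := subring0 hsub.
Let R1 : R 1. Proof. by case: hsub. Qed.
Let RB x y : R x -> R y -> R (x - y). Proof. by case: hsub => _ h _; apply: h. Qed.
Let RM x y : R x -> R y -> R (x * y). Proof. by case: hsub => _ _ h; apply: h. Qed.
Let RD x y : R x -> R y -> R (x + y). Proof. exact: subringD. Qed.

Lemma a_lt j k : (j < k)%N -> a j < a k.
Proof.
move=> /subnK <-; elim: (k - j.+1)%N => [|m IH] //.
by rewrite addSn; apply: lt_trans IH _.
Qed.

Lemma a_le j k : (j <= k)%N -> a j <= a k.
Proof. by rewrite leq_eqVlt => /predU1P[->//|/a_lt/ltW]. Qed.

Lemma a_le_inv j k : a j <= a k -> (j <= k)%N.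
Proof. by move=> h; rewrite leqNgt; apply/negP => /a_lt; rewrite ltNge h. Qed.

Lemma subring_integral x : R x -> integral_over R x.
Proof.
move=> hx; exists ('X - x%:P); split; first exact: monicXsubC.
  move=> k; rewrite coefB coefX coefC; apply: RB.
    by case: (k == 1)%N.
  by case: (k == 0)%N.
by rewrite root_XsubC.
Qed.

Lemma integral_vge x : vge v 0 x -> integral_over R x.
Proof.
have [->|x0] := eqVneq x 0; first by move=> _; apply: subring_integral.
by move/(vge_val x0) => h; case: hv => _ _ _ H; apply/H.
Qed.

Lemma R_vge0 r : R r -> vge v 0 r.
Proof. by move/subring_integral; apply: (vge0 hv). Qed.

Lemma exists_val j : exists y, [/\ R y, y != 0 & v y = a j].
Proof. by apply/ha_H; exists j. Qed.

Lemma val_in_H r : R r -> r != 0 -> exists j, v r = a j.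
Proof. by move=> hr r0; apply/ha_H; exists r. Qed.

(** The quotient [x / y] is integral, and its residue lifts to [R]. *)
Lemma residue_approx x y : y != 0 -> vge v (v y) x ->
  exists2 r, R r & vge v (v y + 1) (x - r * y).
Proof.
move=> y0 hx; have [|r [hr h]] := hres_surj (x := x / y).
  by apply: integral_vge; rewrite -(subrr (v y)); exact: (vge_div hv y0 hx).
exists r => //; have -> : x - r * y = y * (x / y - r) by field.
by apply: (vgeM hv); [right | apply: vgt_vge h].
Qed.

Lemma Iv0 j : I j 0.
Proof. by split=> //; left. Qed.

Lemma IvD j x y : I j x -> I j y -> I j (x + y).
Proof. by move=> [h1 h2] [h3 h4]; split; [apply: RD | apply: (vgeD hv)]. Qed.

Lemma IvB j x y : I j x -> I j y -> I j (x - y).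
Proof. by move=> [h1 h2] [h3 h4]; split; [apply: RB | apply: (vgeB hv)]. Qed.

Lemma IvM j r x : R r -> I j x -> I j (r * x).
Proof.
move=> hr [hx vx]; split; first exact: RM.
by rewrite -(add0r (a j)); apply: (vgeM hv) => //; apply: R_vge0.
Qed.

Lemma Iv_val j x : R x -> v x = a j -> I j x.
Proof. by move=> hx e; split=> //; right; rewrite e. Qed.

Lemma Iv_anti j k x : (j <= k)%N -> I k x -> I j x.
Proof. by move=> /a_le h [hx vx]; split=> //; apply: vge_le vx. Qed.

(** No element of [R] has a value strictly between [a j] and [a j.+1]. *)
Lemma Iv_gt j x : R x -> vge v (a j + 1) x -> I j.+1 x.
Proof.
move=> hx vx; split=> //; have [->|x0] := eqVneq x 0; first by left.
right; have [k e] := val_in_H hx x0; have := vge_val x0 vx.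
rewrite e => h; apply: a_le; rewrite ltnNge; apply/negP => /a_le; lia.
Qed.

Lemma Iv_next j x : I j x -> v x != a j -> I j.+1 x.
Proof.
move=> [hx vx] ne; apply: Iv_gt => //; case: vx => [->|h]; [by left | right].
by move/eqP: ne; lia.
Qed.

(** Cancellation of the leading term; repeated use expands elements of [I i] along chosen elements
    of successive values. *)
Lemma Iv_step j w x : R w -> w != 0 -> v w = a j -> I j x ->
  exists2 r, R r & I j.+1 (x - r * w).
Proof.
move=> hw w0 e [hx vx]; have [|r hr h] := residue_approx w0 (x := x).
  by rewrite e.
exists r => //; apply: Iv_gt; last by rewrite -e.
by apply: RB => //; apply: RM.
Qed.

(** * The conductor *)

Lemma common_denominator k (g : 'I_k -> K) :
  exists d, [/\ R d, d != 0 & forall j : 'I_k, R (d * g j)].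
Proof.
elim: k g => [|k IH] g; first by exists 1; rewrite oner_neq0; split=> // -[].
have [d [hd d0 h]] := IH (fun j => g (lift ord0 j)).
have [c [b [hc hb b0 e]]] := hfrac (g ord0).
exists (b * d); split; [exact: RM | exact: mulf_neq0 |].
move=> j; case: (unliftP ord0 j) => [j' ->|->].
  by rewrite -mulrA; apply: RM.
rewrite e (_ : b * d * (c / b) = d * c); last by field.
exact: RM.
Qed.

Lemma integral_denominator :
  exists2 d, d != 0 & forall x, integral_over R x -> R (d * x).
Proof.
case: hfin => k [g hg]; have [d [_ d0 h]] := common_denominator g.
exists d => // x /hg [c [hc ->]]; rewrite mulr_sumr; apply: (subring_sum hsub) => j.
by rewrite mulrCA; apply: RM.
Qed.

(* Subtracting elements of R with the same value and residue pushes the value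
   of x up until x lies in a fixed multiple d Rbar contained in R. *)
Lemma conductor x : vge v (a n) x -> R x.
Proof.
have [d d0 hd] := integral_denominator.
have claim m : forall y, vge v (a n) y -> vge v (v d - m%:Z) y -> R y.
  elim: m => [|m IH] y hy hyd.
    rewrite -(mulfVK d0 y) mulrC; apply/hd/integral_vge.
    by rewrite -(subrr (v d)); apply: (vge_div hv) => //; rewrite subr0 in hyd.
  have [->//|y0] := eqVneq y 0.
  (* From [a n] on every integer is a value by [hn]; this index is the one whose value is [v y]. *)
  have [w [hw w0 ew]] := exists_val (n + `|v y - a n|)%N.
  have ey : v w = v y by rewrite ew hn; have := vge_val y0 hy; lia.
  have [|r hr h] := residue_approx w0 (x := y); first by right; rewrite ey.
  rewrite -(subrK (r * w) y); apply: RD; last exact: RM.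
  apply: IH; apply: vge_le h; rewrite ey.
    by have := vge_val y0 hy; lia.
  by have := vge_val y0 hyd; lia.
move=> hx; have [->//|x0] := eqVneq x 0.
by apply: (claim `|v d - v x|%N x hx); right; lia.
Qed.

(** * Consequences of the hypothesis on trace ideals of [R] *)

Lemma in_T_Iv j : (j <= n)%N -> in_T R (I j).
Proof. by move=> hj; apply/hIT; exists j. Qed.

Lemma colon_R_Iv j : (j <= n)%N -> subI (colon R (I j)) (colon (I j) (I j)).
Proof. by move=> /in_T_Iv/(in_T_iff hsub) []. Qed.

(** As [I n] is a trace ideal, [x] maps it into itself and cannot lower the value of an element of
    value [a n]. *)
Lemma colon_R_conductor x : colon R (I n) x -> vge v 0 x.
Proof.
move=> /(colon_R_Iv (leqnn n)) h; have [y [hy y0 e]] := exists_val n.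
have [_ hxy] := h y (Iv_val hy e).
by apply: (vge_divr hv y0); rewrite add0r e.
Qed.

(* The trace of R w + I_(l+1) contains w, so it is some I_k with k <= p and has
   an element of value a_l; modulo values >= a_(l+1) that element is xi w with
   xi in R : (R w + I_(l+1)). *)
Lemma exists_mul_next p l w : R w -> w != 0 -> v w = a p -> (p < l)%N ->
  exists y, [/\ R y, y != 0, v y = a l & forall z, I l.+1 z -> R (y * z / w)].
Proof.
move=> hw w0 ew hpl.
(* For [n <= l] any [y] of value [a l] works: [y * z / w] has value above [a n] and lies in the
   conductor. *)
have [hnl|hln] := leqP n l.
  have [y [hy y0 ey]] := exists_val l; exists y; split=> // z [_ vz].
  apply: conductor.
  have vy : vge v (a l) y by right; rewrite ey.
  apply: vge_le (vge_div hv w0 (vgeM hv vy vz)); rewrite ew.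
  by have := a_le hnl; have := a_lt hpl; have := ha_incr l; lia.
pose X x := exists2 r, R r & I l.+1 (x - r * w).
have XI z : I l.+1 z -> X z by move=> hz; exists 0; rewrite // mul0r subr0.
have XD x y : X x -> X y -> X (x + y).
  move=> [r hr hx] [s hs hy]; exists (r + s); first exact: RD.
  have -> : x + y - (r + s) * w = (x - r * w) + (y - s * w) by ring.
  exact: IvD.
have XM r x : R r -> X x -> X (r * x).
  move=> hr [s hs hx]; exists (r * s); first exact: RM.
  have -> : r * x - r * s * w = r * (x - s * w) by ring.
  exact: IvM.
have XR x : X x -> R x.
  move=> [r hr [hx _]]; rewrite -(subrK (r * w) x); apply: RD => //; exact: RM.
have Xw : X w by exists 1; rewrite // mul1r subrr; apply: Iv0.
have C1 : colon R X 1 by move=> x hx; rewrite mul1r; apply: XR.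
have /hIT [k [_ ek]] : in_T R (prodI (colon R X) X).
  apply: in_T_trace => //; first exact/XI/Iv0.
  by exists 1 => //; exists w; rewrite // mul1r.
have hkp : a k <= a p.
  rewrite -ew; apply: (vge_val w0).
  by have [|_] := (ek w).1; rewrite -1?(mul1r w) //; apply: prodI_mul.
have [y0 [hy0 nz ey0]] := exists_val l.
have hy : prodI (colon R X) X y0.
  apply/ek; split=> //; right; rewrite ey0.
  by apply: le_trans hkp _; apply: a_le; apply: ltnW.
have [xi hxi hd] : exists2 xi, colon R X xi & vge v (a l.+1) (xi * w - y0).
  move: y0 hy {hy0 nz ey0}; apply: prodI_ind.
  - exists 0; first by move=> x _; rewrite mul0r.
    by left; rewrite mul0r subr0.
  - move=> x y [s hs hx] [t ht hy]; exists (s + t).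
      by move=> z hz; rewrite mulrDl; apply: RD; [apply: hs | apply: ht].
    have -> : (s + t) * w - (x + y) = (s * w - x) + (t * w - y) by ring.
    exact: (vgeD hv).
  (* Since [l < n], [s] maps [I n] into [R], so it has nonnegative value and keeps the error at
     value at least [a l.+1]. *)
  - move=> s x hs [r hr [_ hx]]; exists (s * r).
      by move=> z hz; rewrite -mulrA; apply/hs/XM.
    have -> : s * r * w - s * x = - (s * (x - r * w)) by ring.
    apply/(vgeN hv); rewrite -(add0r (a _)); apply: (vgeM hv) => //.
    by apply: colon_R_conductor => z hz; apply/hs/XI; apply: Iv_anti hz.
have [|s0 es] := val_perturb hv nz _ hd; first by rewrite ey0.
exists (xi * w); split; rewrite ?es //; first exact: hxi.
move=> z hz; have -> : xi * w * z / w = xi * z by field.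
exact/hxi/XI.
Qed.

(** For a unit [r] of [R] with the residue of [x], [e = 1 - x / r] has positive value. The geometric
    series for [r / x] in powers of [e] can be cut off at [N >= a n], because the remainder then
    lies in the conductor. *)
Lemma overring_unit (A : K -> Prop) x : subring A -> subI R A ->
  A x -> x != 0 -> v x = 0 -> A x^-1.
Proof.
move=> hA hRA hx x0 ex; case: (hA) => A1 AB AM.
have [|r [hr h]] := hres_surj (x := x); first by apply: integral_vge; right; rewrite ex.
have {h} h : vge v 1 (r - x).
  by rewrite -(opprB x r); apply/(vgeN hv); rewrite -(add0r 1); apply: vgt_vge.
have [|r0 er] := val_perturb hv x0 _ h; first by rewrite ex.
have hrV : R r^-1.
  apply: contrapT => hrV.
  have /(hres_inj hr) [/eqP|] : nonunit_in R r by split=> // -[_ []].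
    by rewrite (negPf r0).
  by rewrite er ex ltxx.
pose e := 1 - x / r.
have he : A e by apply: AB => //; apply: AM => //; apply: hRA.
have ve : vge v 1 e.
  have -> : e = (r - x) / r by rewrite /e; field.
  by have := vge_div hv r0 h; rewrite er ex subr0.
pose N := `|a n|%N.
have AX m : A (e ^+ m) by elim: m => [|m IH]; rewrite ?expr0 // exprS; apply: AM.
have geom : x / r * \sum_(k < N) e ^+ k = 1 - e ^+ N.
  by rewrite -(opprB _ 1) subrX1 -mulNr opprB /e subKr.
have -> : x^-1 = r^-1 * (\sum_(k < N) e ^+ k + e ^+ N * (r / x)).
  apply: (mulfI x0); rewrite mulfV // !mulrA mulrDr geom.
  by field; rewrite x0 r0.
apply: (AM) => //; first exact: hRA.
apply: (subringD hA); first by apply: (subring_sum hA).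
have vrx : vge v 0 (r / x).
  by right; rewrite (valuationM hv) ?invr_eq0 // (valuationV hv) // er subrr.
apply/hRA/conductor; apply: vge_le (vgeM hv (vgeX hv N ve) vrx).
by rewrite /N; lia.
Qed.

(** * Trace ideals of the endomorphism ring of [I i] *)

Section EndomorphismRing.
Variables (i : nat) (q : K).
Hypotheses (hi : (1 <= i <= n)%N) (hq : R q) (hq0 : q != 0) (hvq : v q = a i).

Local Notation A := (colon (I i) (I i)).
Local Notation stable := (eqI (prodI (I i) (I i)) (scaleI q (I i))).

Let i_le_n : (i <= n)%N. Proof. by case/andP: hi. Qed.
Let Iq : I i q := Iv_val hq hvq.

Lemma A_subring : subring A.
Proof. by apply: colon_subring; [apply: Iv0 | apply: IvB]. Qed.

Lemma R_sub_A : subI R A.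
Proof. by move=> r hr x hx; apply: IvM. Qed.

Lemma A_mulq x : A x -> I i (q * x).
Proof. by move=> hx; rewrite mulrC; apply: hx. Qed.

Lemma A_vge0 x : A x -> vge v 0 x.
Proof.
by move=> hx; have [_ h] := hx q Iq; apply: (vge_divr hv hq0); rewrite add0r hvq.
Qed.

(* J = (A : J) J and A = R : I_i give (R : I_i J) I_i J = I_i J, so I_i J is a
   trace ideal of R. *)
Lemma in_T_A_prodI J : in_T A J ->
  exists j, (i <= j <= n)%N /\ eqI (prodI (I i) J) (I j).
Proof.
move=> /(in_T_iff A_subring) [[hJA hJ0 hJD hJM] [x0 [hx0 nz]] hc].
have sub : subI (prodI (I i) J) (I i).
  apply: prodI_ind; [exact: Iv0 | exact: IvD |].
  by move=> x y hx hy; rewrite mulrC; apply: hJA.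
have /hIT [j [hj ej]] : in_T R (prodI (I i) J).
  apply/(in_T_iff hsub); split.
  - split; [by move=> x /sub [] | exact: prodI0 | exact: prodI_add |].
    by move=> r x hr; apply: prodI_scale => y; apply/hJM/R_sub_A.
  - by exists (q * x0); split; [apply: prodI_mul | apply: mulf_neq0].
  - move=> z hz; suff zJ : colon A J z by apply: prodI_scale; apply: hc.
    move=> y hy; apply: (colon_R_Iv i_le_n) => x hx.
    by rewrite -mulrA (mulrC y); apply/hz/prodI_mul.
exists j; split=> //; rewrite hj andbT; apply: a_le_inv.
have [y [hy y0 ey]] := exists_val j; have /ej/sub[_] := Iv_val hy ey.
by rewrite -ey; apply: vge_val.
Qed.

(** A multiplier of [q^-1 I_j] into [A] carries [I_j], hence [I_n], into [R]. So its value is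
    nonnegative, and it maps [I_j] into itself. *)
Lemma in_T_A_scale j : (i <= j <= n)%N -> (forall x, I j x -> A (q^-1 * x)) ->
  in_T A (scaleI q^-1 (I j)).
Proof.
move=> /andP[hij hjn] hA; apply/(in_T_iff A_subring); split.
- split.
  + by move=> _ [x [hx ->]]; apply: hA.
  + by apply/(scaleIV _ _ hq0); rewrite mulr0; apply: Iv0.
  + move=> x y /(scaleIV _ _ hq0) hx /(scaleIV _ _ hq0) hy.
    by apply/(scaleIV _ _ hq0); rewrite mulrDr; apply: IvD.
  + move=> r x hr /(scaleIV _ _ hq0) hx; apply/(scaleIV _ _ hq0); rewrite mulrCA.
    have [hR _] := hr _ (Iv_anti hij hx); split=> //; case: hx => _ hx.
    by rewrite -(add0r (a j)); apply: (vgeM hv) => //; apply: A_vge0.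
- have [y [hy y0 e]] := exists_val j; exists (q^-1 * y).
  by split; [exists y; split=> //; apply: Iv_val | rewrite mulf_neq0 ?invr_eq0].
- move=> x hx.
  have hxw w : I j w -> R (x * w).
    move=> hw; have /hx/A_mulq [] : scaleI q^-1 (I j) (q^-1 * w) by exists w.
    by rewrite mulrCA mulVKf.
  have vx : vge v 0 x.
    by apply: colon_R_conductor => w hw; apply/hxw/(Iv_anti hjn).
  move=> y /(scaleIV _ _ hq0) hy; apply/(scaleIV _ _ hq0); rewrite mulrCA.
  split; first exact: hxw.
  by case: hy => _ hy; rewrite -(add0r (a j)); apply: (vgeM hv).
Qed.

Lemma in_T_eqI (B J J' : K -> Prop) : eqI J J' -> in_T B J' -> in_T B J.
Proof.
move=> e [[M [act [hM hJ]]] [x [hx reg]]]; split; last by exists x; split=> //; apply/e.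
exists M, act; split=> // y; split; first by move/e/hJ.
by move/hJ/e.
Qed.

Lemma in_T_A_self : in_T A A.
Proof.
apply/(in_T_iff A_subring); case: (A_subring) => A1 _ AM; split=> //.
- by split=> //; [apply: subring0 A_subring | apply: subringD A_subring].
- by exists 1; split=> //; apply: oner_neq0.
Qed.

(** Only the inclusion of [I_i^2] in [q I_i] is at stake, as [q] belongs to [I_i]; it says that
    [q^-1 x] multiplies [I_i] into itself for each [x] in [I_i]. *)
Lemma stableP : stable <-> forall x, I i x -> A (q^-1 * x).
Proof.
split=> [e x hx y hy|h z].
  have /e [t [ht et]] := prodI_mul hx hy.
  by rewrite -mulrA et mulKf.
split.
  move: z; apply: prodI_ind; first by exists 0; rewrite mulr0; split=> //; apply: Iv0.
    move=> _ _ [s [hs ->]] [t [ht ->]]; exists (s + t); rewrite mulrDr.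
    by split=> //; apply: IvD.
  move=> x y hx hy; exists (q^-1 * x * y); split; first exact: h.
  by rewrite -mulrA mulVKf.
by move=> [t [ht ->]]; apply: prodI_mul.
Qed.

Lemma in_T_A_stable J : stable ->
  in_T A J <-> exists j, (i <= j <= n)%N /\ eqI J (scaleI q^-1 (I j)).
Proof.
move/stableP => hA; split.
  move=> hJ; have [j [hj e]] := in_T_A_prodI hJ; exists j; split=> // x.
  have [[_ hJ0 hJD hJM] _ _] := (in_T_iff A_subring _).1 hJ.
  split=> [hx|/(scaleIV _ _ hq0)/e].
    by apply/(scaleIV _ _ hq0)/e; apply: prodI_mul.
  (* By stability [I_i] is contained in [q A], so [I_i J] is contained in [q J]. *)
  suff h : subI (prodI (I i) J) (fun s => J (q^-1 * s)) by move/h; rewrite mulKf.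
  apply: prodI_ind; first by rewrite mulr0.
    by move=> s t hs ht; rewrite mulrDr; apply: hJD.
  by move=> s t hs ht; rewrite mulrA; apply: hJM => //; apply: hA.
move=> [j [hj e]]; apply: (in_T_eqI e); apply: in_T_A_scale => // x hx.
by apply/hA; apply: Iv_anti hx; case/andP: hj.
Qed.

(* With y of value a_(i+1) and u of value a_l taken from [exists_mul_next] for q
   and for y, one has u z / q = u (z y / q) / y with z y / q in I_(l+1). *)
Lemma exists_mul_Iv2 : exists y, [/\ R y, y != 0, v y = a i.+1,
    forall z, I i.+2 z -> R (y * z / q)
  & forall z z', I i.+2 z -> I i.+2 z' -> R (z * z' / q)].
Proof.
have [y [hy y0 ey hyz]] := exists_mul_next hq hq0 hvq (ltnSn i).
exists y; split=> //.
(* Descending induction on [l], with [m] bounding the distance to [n]; once [l >= n] the product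
   over [q] lies in the conductor. *)
suff claim m l : (n <= l + m)%N -> (i.+2 <= l)%N ->
    forall z z', I l z -> I l z' -> R (z * z' / q).
  by apply: (claim n i.+2) => //; rewrite leq_addl.
elim: m l => [|m IH] l hnl hil z z' hz hz'.
  case: hz => _ hz; case: hz' => _ hz'; apply: conductor.
  apply: vge_le (vge_div hv hq0 (vgeM hv hz hz')); rewrite hvq.
  rewrite addn0 in hnl; have := a_le hnl.
  by have := a_le (ltnW (ltnW hil)); lia.
have [u [hu u0 eu huz]] := exists_mul_next hy y0 ey hil.
have uR x : I l x -> R (u * x / q).
  move=> hx; have -> : u * x / q = u * (y * x / q) / y by field; rewrite hq0 y0.
  apply: huz; apply: Iv_gt; first by apply: hyz; apply: Iv_anti hx.
  case: hx => _ hx; have vy : vge v (a i.+1) y by right; rewrite ey.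
  apply: vge_le (vge_div hv hq0 (vgeM hv vy hx)); rewrite hvq.
  by have := ha_incr i; lia.
have [r hr ht] := Iv_step hu u0 eu hz.
have [r' hr' ht'] := Iv_step hu u0 eu hz'.
(* Leading terms are split off along [u]: the remainders fall under the induction hypothesis, and
   the cross terms under [uR]. *)
have -> : z * z' / q = (z - r * u) * (z' - r' * u) / q
    + r * (u * z' / q) + r' * (u * (z - r * u) / q) by field.
apply: RD; first apply: RD.
- by apply: (IH l.+1) => //; [rewrite addSnnS | apply: ltnW].
- by apply: RM => //; apply: uR.
- by apply: RM => //; apply: uR; apply: Iv_anti ht.
Qed.

(** Modulo [I_(i+2)], elements of [I_i] are [R]-combinations of [q] and [y]. Multiplication by
    [z / q] sends [q] to [z], and [exists_mul_Iv2] handles [y] and the remainder. *)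
Lemma Iv2_A z : I i.+2 z -> A (q^-1 * z).
Proof.
have [y [hy y0 ey hyz hzz]] := exists_mul_Iv2 => hz x hx.
have [r hr hx1] := Iv_step hq hq0 hvq hx.
have [r' hr' hx2] := Iv_step hy y0 ey hx1.
split.
  have -> : q^-1 * z * x = r * z + r' * (y * z / q)
      + z * (x - r * q - r' * y) / q by field.
  apply: RD; last exact: hzz.
  apply: RD; apply: RM => //; [by case: hz | exact: hyz].
case: hz => _ hz; case: hx => _ hx; rewrite -mulrA mulrC.
apply: vge_le (vge_div hv hq0 (vgeM hv hz hx)); rewrite hvq.
by have := ha_incr i; have := ha_incr i.+1; lia.
Qed.

(** If [q x] had value [a_(i+1)], then [q] and [q x] would generate [I_i] modulo [I_(i+2)]. Since
    [1], [x] and [q^-1 I_(i+2)] lie in [A], so would [q^-1 I_i], which is stability. *)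
Lemma A_unit_or_Iv2 x : ~ stable -> A x -> v x = 0 \/ I i.+2 (q * x).
Proof.
move=> nst hx; have [->|x0] := eqVneq x 0; first by right; rewrite mulr0; apply: Iv0.
have h := A_mulq hx; have vqx : v (q * x) = a i + v x by rewrite (valuationM hv) // hvq.
have [e|ne] := eqVneq (v (q * x)) (a i); first by left; lia.
have h1 := Iv_next h ne.
have [e|ne1] := eqVneq (v (q * x)) (a i.+1); last by right; apply: Iv_next.
case: nst; apply/stableP => w hw.
have [r hr hw1] := Iv_step hq hq0 hvq hw.
have [r' hr' hw2] := Iv_step h.1 (mulf_neq0 hq0 x0) e hw1.
have -> : q^-1 * w = r + r' * x + q^-1 * (w - r * q - r' * (q * x)) by field.
case: (A_subring) => _ _ AM.
apply: (subringD A_subring); last exact: Iv2_A.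
apply: (subringD A_subring); first exact: R_sub_A.
by apply: AM => //; apply: R_sub_A.
Qed.

Lemma in_T_A_unstable J : ~ stable ->
  in_T A J <-> (exists j, (i.+2 <= j <= n)%N /\ eqI J (scaleI q^-1 (I j))) \/ eqI J A.
Proof.
move=> nst; split; last first.
  case=> [[j [/andP[hij hj] e]]|e]; last exact: in_T_eqI in_T_A_self.
  apply: (in_T_eqI e); apply: in_T_A_scale.
    by rewrite hj andbT (leq_trans _ hij) // ltnW.
  by move=> x hx; apply/Iv2_A; apply: Iv_anti hx.
move=> hJ; have [[hJA hJ0 hJD hJM] _ hc] := (in_T_iff A_subring _).1 hJ.
(* An element of value 0 is a unit of [A] by [overring_unit], so it forces [J = A]. *)
have [[x [hx x0 ex]]|nounit] := pselect (exists x, [/\ J x, x != 0 & v x = 0]).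
  right=> y; split; first exact: hJA.
  move=> hy; rewrite -(mulfVK x0 y); apply: hJM => //.
  case: (A_subring) => _ _ AM; apply: AM => //.
  by apply: overring_unit => //; [exact: A_subring | exact: R_sub_A | exact: hJA].
left; have J2 x : J x -> I i.+2 (q * x).
  move=> hx; have [->|x0] := eqVneq x 0; first by rewrite mulr0; apply: Iv0.
  by case: (A_unit_or_Iv2 nst (hJA _ hx)) => // ex; case: nounit; exists x.
have [j [/andP[hij hj] e]] := in_T_A_prodI hJ.
have [y [hy y0 ey hyz _]] := exists_mul_Iv2.
(* It suffices that [y / q] maps [J] into [A], because [J] is a trace ideal. *)
have yJ x : J x -> J (y / q * x).
  apply: hc => t ht.
  have -> : y / q * t = q^-1 * (y * (q * t) / q) by field.
  apply: Iv2_A; have h2 := J2 t ht; split; first exact: hyz.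
  case: h2 => _ h2; have vy : vge v (a i.+1) y by right; rewrite ey.
  apply: vge_le (vge_div hv hq0 (vgeM hv vy h2)); rewrite hvq.
  by have := ha_incr i; lia.
(* Expanding [s] along [q] and [y] leaves a remainder in [I_(i+2)], which is [q] times an element of
   [A]. *)
have sub : subI (prodI (I i) J) (fun s => J (q^-1 * s)).
  apply: prodI_ind; first by rewrite mulr0.
    by move=> s t hs ht; rewrite mulrDr; apply: hJD.
  move=> s t hs ht.
  have [r hr hs1] := Iv_step hq hq0 hvq hs.
  have [r' hr' hs2] := Iv_step hy y0 ey hs1.
  have -> : q^-1 * (s * t) = r * t + r' * (y / q * t)
      + q^-1 * (s - r * q - r' * y) * t by field.
  apply: (hJD); last by apply: hJM => //; apply: Iv2_A.
  by apply: hJD; apply: hJM; [exact: R_sub_A | | exact: R_sub_A | exact: yJ].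
have eJ : eqI J (scaleI q^-1 (I j)).
  move=> x; split=> [hx|/(scaleIV _ _ hq0)/e/sub]; last by rewrite mulKf.
  by apply/(scaleIV _ _ hq0)/e; apply: prodI_mul.
(* The bound [i + 2 <= j] comes from an element of value [a_j] in [q J], which [J2] places in
   [I_(i+2)]. *)
exists j; split=> //; rewrite hj andbT; apply: a_le_inv.
have [w [hw w0 ew]] := exists_val j.
have /eJ/J2 : scaleI q^-1 (I j) (q^-1 * w) by exists w; split=> //; apply: Iv_val.
by rewrite mulVKf // -ew => -[_]; apply: vge_val.
Qed.

Lemma in_T_A_finite :
  exists k (F : 'I_k -> (K -> Prop)), forall J, in_T A J <-> exists j, eqI J (F j).
Proof.
exists n.+1; have [st|nst] := pselect stable.
  (* Indices below [i] repeat the ideal at [i]. *)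
  exists (fun j => scaleI q^-1 (I (maxn i j))) => J; split.
    move=> /(in_T_A_stable J st) [j [/andP[hij hj] e]].
    by exists (inord j); rewrite inordK // (maxn_idPr hij).
  move=> [j e]; apply/(in_T_A_stable J st); exists (maxn i j); split=> //.
  by rewrite leq_maxl geq_max i_le_n -ltnS ltn_ord.
(* Index 0 always falls in the second branch, so [A] is listed even when no [j <= n] reaches
   [i.+2]. *)
exists (fun j => if (i.+2 <= j)%N then scaleI q^-1 (I j) else A) => J; split.
  move=> /(in_T_A_unstable J nst) [[j [/andP[hij hj] e]]|e].
    by exists (inord j); rewrite inordK // hij.
  by exists ord0.
move=> [j e]; apply/(in_T_A_unstable J nst); move: e.
case: ifP => h e; [left | by right].
by exists j; rewrite h -ltnS ltn_ord.
Qed.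

End EndomorphismRing.

End ValueFiltration.

Theorem theorem3p11 (K : fieldType) (R : K -> Prop) (v : K -> int)
  (a : nat -> int) (n : nat) (i : nat) (q : K)
  (* (R, m, k): one-dimensional local noetherian domain, K = Q(R) *)
  (hsub : subring R) (hfrac : is_frac_field R) (hloc : is_local R)
  (hnoeth : noetherian R) (hdim : krull_dim_one R)
  (* analytically irreducible: Rbar finite over R and local *)
  (hfin : fin_gen_over R (integral_over R))
  (hbarloc : is_local (integral_over R))
  (* v = normalized valuation of Rbar *)
  (hv : normalized_valuation_of (integral_over R) v)
  (* k -> Rbar/n is an isomorphism (m = n /\ R, and surjective) *)
  (hres_inj : forall r, R r -> (nonunit_in R r <-> vgt v 0 r))
  (hres_surj : forall x, integral_over R x -> exists r, R r /\ vgt v 0 (x - r))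
  (* H = v(R) = {a_0 < a_1 < ...} *)
  (ha_incr : forall j, a j < a j.+1)
  (ha_H : forall h, value_set R v h <-> exists j, h = a j)
  (* n is the smallest integer with a_{n+j} = a_n + j for all j *)
  (hn : forall j, a (n + j)%N = a n + j%:Z)
  (hn_min : forall m, (forall j, a (m + j)%N = a m + j%:Z) -> (n <= m)%N)
  (* I(R) = T(R) *)
  (hIT : forall J, in_T R J <-> exists j, (j <= n)%N /\ eqI J (Iv R v a j))
  (hi : (1 <= i <= n)%N)
  (hq : R q) (hq0 : q != 0) (hvq : v q = a i) :
  let A := colon (Iv R v a i) (Iv R v a i) in
  (eqI (prodI (Iv R v a i) (Iv R v a i)) (scaleI q (Iv R v a i)) ->
     forall J, in_T A J <->
       exists j, (i <= j <= n)%N /\ eqI J (scaleI q^-1 (Iv R v a j))) /\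
  (~ eqI (prodI (Iv R v a i) (Iv R v a i)) (scaleI q (Iv R v a i)) ->
     forall J, in_T A J <->
       (exists j, (i.+2 <= j <= n)%N /\ eqI J (scaleI q^-1 (Iv R v a j)))
       \/ eqI J A) /\
  (* in particular T(I_i : I_i) is finite *)
  (exists (k : nat) (F : 'I_k -> (K -> Prop)), forall J, in_T A J <-> exists j, eqI J (F j)).
Proof.
split; first by move=> st J; exact: in_T_A_stable.
split; first by move=> nst J; exact: in_T_A_unstable.
exact: in_T_A_finite hvq.
Qed.
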